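(* Let $D\subset\mathbb{R}^d$ be a domain, let $\mathcal{X}=C(D)$, let $V\neq\{0\}$ be a finite dimensional subspace of $C(D)$, and let $M(f)=(f(P_1),\dots,f(P_m))$, where $P_j\in D$, $j=1,\dots,m$, are $m$ distinct points. Let $\mathcal{N}$ be the null space of $M$ and assume $\mathcal{N}\cap V=\{0\}$. Then $$\frac12\sup_{v\in V\setminus\{0\}}\frac{\|v\|_{C(D)}}{\max_{1\le j\le m}|v(P_j)|}\le\mu(\mathcal{N},V)\le 2\sup_{v\in V\setminus\{0\}}\frac{\|v\|_{C(D)}}{\max_{1\le j\le m}|v(P_j)|}.$$
   Context: $C(D)$ is the real Banach space of (bounded) continuous functions on $D$ with the supremum norm $\|\cdot\|_{C(D)}$; ''domain'' is used loosely so as to include compact domains such as $[0,1]$. For subspaces $X\ne\{0\}$ and $Y$ of a Banach space $\mathcal{X}$, $\mu(X,Y):=\sup_{x\in X\setminus\{0\}}\frac{\|x\|}{\operatorname{dist}(x,Y)}=\sup_{x\in X\setminus\{0\},\,y\in Y}\frac{\|x\|}{\|x-y\|}$. *)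

(* Defs.v *)
From HB Require Import structures.
From mathcomp Require Import all_boot all_order all_algebra.
From mathcomp Require Import all_classical all_reals all_analysis.

Set Implicit Arguments.
Unset Strict Implicit.
Unset Printing Implicit Defensive.

Import Order.TTheory GRing.Theory Num.Theory.
Import numFieldNormedType.Exports.

Local Open Scope classical_set_scope.
Local Open Scope ring_scope.

(* "Domain" in the loose sense that allows any part of the boundary to be
   included, so that an open domain and its closure both qualify. *)
Definition is_domain (R : realType) (d : nat) (D : set 'rV[R]_d) : Prop :=
  exists O : set 'rV[R]_d,
    [/\ O !=set0, open O, connected O, O `<=` D & D `<=` closure O].

Section bounded_continuous_functions.
Context {R : realType} {T : topologicalType}.

Definition bcont : {pred T -> R} :=
  mem [set f : T -> R | continuous f /\ bounded_fun f].

Lemma bcontP (f : T -> R) :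
  reflect (continuous f /\ exists K, forall x, `|f x| <= K) (f \in bcont).
Proof.
apply: (iffP idP).
  rewrite inE => -[cf /pinfty_ex_gt0 [K _ fK]]; split=> //.
  by exists K => x; exact: fK.
move=> [cf [K fK]]; rewrite inE; split=> //; rewrite /= /bounded_near.
exists K; split; first exact: num_real.
by move=> M KM x _ /=; exact: le_trans (fK x) (ltW KM).
Qed.

Lemma bcont_submod_closed : submod_closed bcont.
Proof.
split.
  by apply/bcontP; split; [exact: cst_continuous|exists 0 => x; rewrite normr0].
move=> a f g /bcontP[cf [K fK]] /bcontP[cg [L gL]]; apply/bcontP; split.
  by move=> x; apply: cvgD; [apply: cvgMl_tmp; exact: cf|exact: cg].
exists (`|a| * K + L) => x; rewrite (le_trans (ler_normD _ _))// lerD//.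
by rewrite normrM ler_wpM2l.
Qed.

HB.instance Definition _ :=
  GRing.isSubmodClosed.Build _ _ bcont bcont_submod_closed.

End bounded_continuous_functions.

Record bcfun (R : realType) (T : topologicalType) := BCFun {
  bcfun_val :> T -> R;
  bcfun_valP : bcfun_val \in bcont }.

Section bcfun_normed_module.
Context (R : realType) (T : topologicalType).

HB.instance Definition _ := [isSub for @bcfun_val R T].
HB.instance Definition _ := [Choice of bcfun R T by <:].
HB.instance Definition _ := [SubChoice_isSubLmodule of bcfun R T by <:].

Implicit Types f g : bcfun R T.

(* The [0] only matters when [T] is empty. *)
Definition sup_norm f : R := sup (0 |` range (fun x => `|f x|)).

Lemma sup_norm_has_sup f : has_sup (0 |` range (fun x => `|f x|)).
Proof.
split; first by exists 0; left.
have /bcontP[_ [K fK]] := bcfun_valP f.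
exists (Num.max 0 K) => _ [->|[x _ <-]]; first by rewrite le_max lexx.
by rewrite le_max fK orbT.
Qed.

Lemma sup_norm_ge0 f : 0 <= sup_norm f.
Proof. by apply: (sup_upper_bound (sup_norm_has_sup f)); left. Qed.

Lemma sup_norm_ge f x : `|f x| <= sup_norm f.
Proof. by apply: (sup_upper_bound (sup_norm_has_sup f)); right; exists x. Qed.

Lemma sup_norm_le f K : 0 <= K -> (forall x, `|f x| <= K) -> sup_norm f <= K.
Proof.
move=> K0 fK; apply: ge_sup; first by exists 0; left.
by move=> _ [->//|[x _ <-]].
Qed.

Lemma sup_normD f g : sup_norm (f + g) <= sup_norm f + sup_norm g.
Proof.
apply: sup_norm_le => [|x]; first by rewrite addr_ge0 ?sup_norm_ge0.
by rewrite (le_trans (ler_normD _ _))// lerD// sup_norm_ge.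
Qed.

Lemma sup_normZ (a : R) f : sup_norm (a *: f) = `|a| * sup_norm f.
Proof.
have le b h : sup_norm (b *: h) <= `|b| * sup_norm h.
  apply: sup_norm_le => [|x]; first by rewrite mulr_ge0 ?sup_norm_ge0.
  by rewrite /= normrM ler_wpM2l// sup_norm_ge.
have [->|a0] := eqVneq a 0.
  rewrite normr0 mul0r; apply/eqP; rewrite eq_le sup_norm_ge0 andbT.
  by rewrite (le_trans (le _ _))// normr0 mul0r.
apply/eqP; rewrite eq_le le/= -ler_pdivlMl ?normr_gt0// -normfV.
by rewrite -[f in leLHS](scalerK a0) le.
Qed.

Lemma sup_norm0_eq0 f : sup_norm f = 0 -> f = 0.
Proof.
move=> f0; apply/val_inj/funext => x; apply/eqP.
by rewrite -normr_le0 -f0; exact: sup_norm_ge.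
Qed.

HB.instance Definition _ := @Lmodule_isNormed.Build R (bcfun R T)
  sup_norm sup_normD sup_normZ sup_norm0_eq0.

Lemma bcfun_normE f : `|f| = sup_norm f. Proof. by []. Qed.

Lemma bcfun_complete (F : set_system (bcfun R T)) :
  ProperFilter F -> cauchy F -> cvg F.
Proof.
move=> FF /cauchy_ballP Fc.
have Fd (e : R) : 0 < e ->
    \forall f & g \near F, forall x, `|(f : bcfun R T) x - (g : bcfun R T) x| <= e.
  move=> e0; apply: filterS (Fc _ e0) => -[f g] /=.
  rewrite -ball_normE /= => fg x.
  exact: le_trans (sup_norm_ge (f - g) x) (ltW fg).
have ptc x : cvg ((fun f : bcfun R T => f x) @ F).
  apply/cauchy_cvgP/cauchy_ballP => e e0; near_simpl.
  have e20 : 0 < e / 2 by rewrite divr_gt0.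
  apply: filterS (Fd _ e20) => -[f g] /= /(_ x) fg.
  by rewrite -ball_normE /= (le_lt_trans fg)// gtr_pMr// invf_lt1// ltr1n.
pose l x : R := lim ((fun f : bcfun R T => f x) @ F).
have Fl (e : R) : 0 < e ->
    \forall f \near F, forall x, `|l x - (f : bcfun R T) x| <= e.
  move=> e0; have e20 : 0 < e / 2 by rewrite divr_gt0.
  near=> f => x; near F => g.
  rewrite (splitr e) -(subrKA (g x)) (le_trans (ler_normD _ _))// lerD//.
    by near: g; move/cvgrPdist_le : (ptc x); exact.
  rewrite distrC; move: (x); near: g; near: f; apply: nearP_dep.
  exact: Fd.
have l_bcont : l \in bcont.
  apply/bcontP; split.
    move=> x; apply/cvgrPdist_le => e e0.
    have e30 : 0 < e / 3 by rewrite divr_gt0.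
    near F => f.
    have fl : forall y, `|l y - f y| <= e / 3 by near: f; exact: Fl.
    have /bcontP[/(_ x)/cvgrPdist_le/(_ _ e30) cf _] := bcfun_valP f.
    near=> y.
    have fxy : `|f x - f y| <= e / 3 by near: y; exact: cf.
    rewrite [leLHS](_ : _ = `|(l x - f x) + (f x - f y) + (f y - l y)|); last first.
      by rewrite !addrA !subrK.
    rewrite (le_trans (ler_normD _ _))// (_ : e = e / 3 + e / 3 + e / 3).
      rewrite lerD ?(distrC _ (l y))//.
      by rewrite (le_trans (ler_normD _ _))// lerD.
    by rewrite -!mulrDl (_ : e + e + e = e * 3) ?mulfK// mulr_natr !mulrSr mulr0n add0r.
  near F => f.
  have fl : forall y, `|l y - f y| <= 1 by near: f; exact: Fl.
  exists (1 + `|f|) => x.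
  rewrite -[l x](subrK (f x)) (le_trans (ler_normD _ _))// lerD//.
  exact: sup_norm_ge.
apply/cvg_ex; exists (BCFun l_bcont); apply/cvgrPdist_le => e e0.
apply: filterS (Fl _ e0) => f fl.
by apply: sup_norm_le => [|x]; [exact: ltW|exact: fl].
Unshelve. all: by end_near. Qed.

HB.instance Definition _ :=
  Uniform_isComplete.Build (bcfun R T) bcfun_complete.

End bcfun_normed_module.

(* A subspace is finite dimensional iff it is the span of a finite family. *)
Definition finite_dim_subspace (R : realType) (X : lmodType R) (V : set X) :
    Prop :=
  exists (n : nat) (e : 'I_n -> X),
    V = range (fun c : 'I_n -> R => \sum_(i < n) c i *: e i).

Section mu.
Context {R : realType} {X : completeNormedModType R}.
Local Open Scope ereal_scope.

Definition dist (x : X) (B : set X) : \bar R :=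
  ereal_inf [set `|x - y|%:E | y in B].

(* In [\bar R], [0^-1 = +oo], so a point of [A `\ 0] at distance [0] from [B]
   makes [mu A B] infinite. *)
Definition mu (A B : set X) : \bar R :=
  ereal_sup [set `|x|%:E / dist x B | x in A `\ 0%R].

End mu.

Section sampling.
Context {R : realType} {d m : nat} {D : set 'rV[R]_d}.
Implicit Types (P : 'I_m -> D) (V : set (bcfun R D)).

Definition sampling P (f : bcfun R D) : 'rV[R]_m := \row_(j < m) f (P j).

Definition null_space P : set (bcfun R D) := [set f | sampling P f = 0].

Definition sampling_sup P V : \bar R :=
  ereal_sup [set `|v|%:E / (\big[Num.max/0%R]_(j < m) `|v (P j)|)%:E
            | v in V `\ 0%R]%E.

End sampling.

(* Main.v *)
Require Import Defs.
From HB Require Import structures.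
From mathcomp Require Import all_boot all_order all_algebra.
From mathcomp Require Import all_classical all_reals all_analysis.
From mathcomp Require Import lra.

Set Implicit Arguments.
Unset Strict Implicit.
Unset Printing Implicit Defensive.

Import Order.TTheory GRing.Theory Num.Theory.
Import numFieldNormedType.Exports.

Local Open Scope classical_set_scope.
Local Open Scope ring_scope.

(** Write [N] for the null space of sampling, [M v] for the largest sample
[max_j |v (P j)|] and [L] for the supremum of [|v| / M v] over nonzero [v] in
[V]. Since [N] meets [V] only in [0], [M v > 0] for every such [v].

Lower bound. Truncating [v] at height [M v] gives a continuous function [u]
with [|u| <= M v] that agrees with [v] at every sample point ([clamp]). Hence
[v - u] lies in [N], its distance to [V] is at most [|u| <= M v], and
[|v - u| >= |v| - M v]; this yields [|v| / M v - 1 <= mu N V], which is enough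
when [|v| / M v >= 2]. For smaller ratios it suffices that [mu N V >= 1], which
holds because [0] lies in [V] and [N] contains a nonzero function: a domain of
positive dimension has a point [q] other than the sample points, and the product
of the truncated distances to the sample points does not vanish at [q]
([null_space_neq0]).

Upper bound. If [x] lies in [N] and [y] in [V], then [y] and [y - x] have the
same samples, so [|y| <= L * M y <= L * |x - y|] and
[|x| <= |x - y| + |y| <= (1 + L) * |x - y| <= 2 * L * |x - y|], where [L >= 1]
because no sample exceeds the norm. *)

(** * Bounding the quotient [mu] from below and from above *)

Section mu_bounds.
Context {R : realType} {X : completeNormedModType R}.
Implicit Types (A B : set X) (x y : X).
Local Open Scope ereal_scope.

Lemma dist_ge0 x B : 0 <= dist x B.
Proof. by apply/ereal_infP => _ [y _ <-]; rewrite lee_fin. Qed.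

(** A single pair [(x, y)] bounds [mu] from below. Asking only for an upper
bound [c > 0] on [|x - y|] covers the case where [x] is at distance [0] from
[B] and the quotient is infinite. *)
Lemma mu_ge A B x y (c : R) : A x -> B y -> (0 < c)%R -> (`|x - y| <= c)%R ->
  x != 0%R -> (`|x| / c)%:E <= mu A B.
Proof.
move=> Ax By c0 xyc x0; apply: le_ereal_sup_tmp.
exists (`|x|%:E / dist x B); first by exists x => //; split=> //; apply/eqP.
rewrite EFinM; apply: lee_wpmul2l; first by rewrite lee_fin.
rewrite [leLHS](_ : _ = c%:E^-1); last by rewrite inver gt_eqF.
rewrite lee_pV2 ?inE ?dist_ge0 ?lee_fin ?(ltW c0)//.
by apply: ge_ereal_inf; exists `|x - y|%:E => //; exists y.
Qed.

(** The hypothesis also forces [dist x B > 0] for nonzero [x] in [A], so the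
quotient never takes the value that [0^-1 = +oo] would give it. *)
Lemma mu_le A B (c : R) : (0 < c)%R ->
  (forall x y, A x -> B y -> (`|x| <= c * `|x - y|)%R) -> mu A B <= c%:E.
Proof.
move=> c0 AB; apply/ereal_supP => _ [x [Ax /eqP x0] <-].
have nx0 : (0 < `|x|)%R by rewrite normr_gt0.
have le_dist : (`|x| / c)%:E <= dist x B.
  by apply/ereal_infP => _ [y By <-]; rewrite lee_fin ler_pdivrMr// mulrC AB.
have xc0 : (0 < `|x| / c)%R by rewrite divr_gt0.
rewrite (_ : c%:E = `|x|%:E * (`|x| / c)%:E^-1); last first.
  by rewrite inver gt_eqF// -EFinM invf_div mulrCA divff ?mulr1// gt_eqF.
apply: lee_wpmul2l; first by rewrite lee_fin.
by rewrite lee_pV2 ?inE ?dist_ge0 ?lee_fin ?(ltW xc0).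
Qed.

End mu_bounds.

(** * Truncation of a bounded continuous function *)

Section bcfun_constructions.
Context {R : realType} {T : topologicalType}.
Implicit Types (M : R) (f : bcfun R T).

Lemma clamp_subproof M f :
  (fun x => Num.max (- M) (Num.min M (f x))) \in bcont.
Proof.
have /bcontP[cf _] := bcfun_valP f.
apply/bcontP; split.
  move=> x; apply: (@continuous_max _ _ (cst (- M)) (cst M \min f)).
    exact: cst_continuous.
  by apply: continuous_min; [exact: cst_continuous|exact: cf].
exists `|M| => x; case: (leP M (f x)) => Mf;
  case: (leP (- M)) => ?; have := ler_norm M; have := ler_norm (- M);
  rewrite normrN => ? ?; rewrite ?normrN// ler_norml; apply/andP; split; lra.
Qed.

(** For [M >= 0] this is the truncation of [f] to [[-M, M]]. It supplies
an interpolant of the samples of [f] whose norm is at most the largest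
sample, without any extension theorem. *)
Definition clamp M f : bcfun R T := BCFun (clamp_subproof M f).

Lemma norm_clamp M f : 0 <= M -> `|clamp M f| <= M.
Proof.
move=> M0; apply: sup_norm_le => // x /=.
by rewrite ler_norml le_max lexx/= ge_max ge_min lexx/= andbT; lra.
Qed.

Lemma clamp_id M f x : `|f x| <= M -> clamp M f x = f x.
Proof. by rewrite ler_norml => /andP[h1 h2] /=; rewrite min_r// max_r. Qed.

End bcfun_constructions.

(** * Points of an open set outside a finite family *)

(** A ball around a point of [O] contains [m + 1] distinct points on a line
directed by [u], too many for a family of [m] points to cover. *)
Lemma open_avoids_finite (R : realType) (X : normedModType R) (u : X)
    (O : set X) (m : nat) (p : 'I_m -> X) : u != 0 -> open O -> O !=set0 ->
  exists2 q, O q & forall j, q != p j.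
Proof.
move=> u0 oO [a Oa].
have /nbhs_ballP[e /= e0 eO] := open_nbhs_nbhs (conj oO Oa).
have nu0 : 0 < `|u| by rewrite normr_gt0.
(* The 2 in the denominator keeps the step [`|t i *: u| = e / (2 + i)] below
   the radius [e], also for [i = 0]. *)
pose t (i : 'I_m.+1) : R := e / (2 + i%:R) / `|u|.
pose q i := a + t i *: u.
have t0 i : 0 < t i by rewrite !divr_gt0// ltr_wpDr.
have Oq i : O (q i).
  apply: eO; rewrite -ball_normE /= opprD addNKr normrN normrZ gtr0_norm//.
  rewrite divfK ?gt_eqF// ltr_pdivrMr ?ltr_wpDr//.
  have : 0 <= i%:R :> R by [].
  by move=> i0; nra.
have q_inj : injective q.
  move=> i k /addrI/eqP; rewrite -subr_eq0 -scalerBl scaler_eq0 (negPf u0) orbF.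
  rewrite subr_eq0 /t -!mulrA => /eqP/(mulfI (lt0r_neq0 e0)) tik.
  have /(mulIf _)/invr_inj/addrI/eqP := tik.
  by rewrite invr_eq0 lt0r_neq0// eqr_nat => /(_ isT)/eqP/val_inj.
apply: contrapT => none.
have hit i : exists j, q i = p j.
  apply: contrapT => nohit; apply: none; exists (q i) => // j.
  by apply/eqP => qp; apply: nohit; exists j.
have [g qg] := choice hit.
have /leq_card : injective g by move=> i k gik; apply: q_inj; rewrite !qg gik.
by rewrite !card_ord ltnn.
Qed.

(** * Samples of functions and the null space of sampling *)

Section sampling_theory.
Context {R : realType} {d m : nat} {D : set 'rV[R]_d}.
Implicit Types (P : 'I_m -> D) (V : set (bcfun R D)) (f v : bcfun R D).

Definition sample_max P f : R := \big[Num.max/0]_(j < m) `|f (P j)|.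

Lemma sample_le_max P f j : `|f (P j)| <= sample_max P f.
Proof. exact: le_bigmax. Qed.

Lemma sample_max_le P f c : 0 <= c -> (forall j, `|f (P j)| <= c) ->
  sample_max P f <= c.
Proof. by move=> c0 fc; apply: bigmax_le => // j _; exact: fc. Qed.

Lemma sample_max_ge0 P f : 0 <= sample_max P f.
Proof. exact: bigmax_ge_id. Qed.

Lemma sample_max_le_norm P f : sample_max P f <= `|f|.
Proof. by apply: sample_max_le => // j; exact: sup_norm_ge. Qed.

Lemma null_spaceP P f : null_space P f <-> forall j, f (P j) = 0.
Proof.
split=> [/= /rowP f0 j|f0]; first by have := f0 j; rewrite !mxE.
by apply/rowP => j; rewrite !mxE.
Qed.

Lemma sample_max_gt0 P V v : null_space P `&` V = [set 0] -> V v -> v != 0 ->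
  0 < sample_max P v.
Proof.
move=> NV0 Vv v0; rewrite lt_neqAle sample_max_ge0 andbT.
apply: contra v0 => /eqP v0; apply/eqP.
suff : (null_space P `&` V) v by rewrite NV0.
split=> //; apply/null_spaceP => j; apply/eqP.
by rewrite -normr_le0 v0; exact: sample_le_max.
Qed.

(** Positivity of the largest sample keeps the quotients finite, which turns
the extended division into division in [R]. *)
Lemma sampling_supE P V : null_space P `&` V = [set 0] -> sampling_sup P V =
  ereal_sup [set (`|v| / sample_max P v)%:E | v in V `\ 0].
Proof.
move=> NV0; congr ereal_sup; apply: eq_imagel => v [Vv /eqP v0].
by rewrite -/(sample_max P v) inver gt_eqF ?(sample_max_gt0 NV0).
Qed.

(** The product over [j] of the distances to [P j], each truncated at [1] so
that the product is bounded, vanishes exactly at the sample points; a domain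
of positive dimension has other points. *)
Lemma null_space_neq0 P : (0 < d)%N -> is_domain D ->
  exists2 f, null_space P f & f != 0.
Proof.
move=> d_gt0 [U [U0 oU _ UD _]].
have u0 : const_mx 1 != 0 :> 'rV[R]_d.
  apply/eqP => /rowP/(_ (Ordinal d_gt0)); rewrite !mxE => /eqP.
  by rewrite oner_eq0.
have [q Uq qP] := open_avoids_finite (fun j => val (P j)) u0 oU U0.
pose h (x : D) := \prod_(j < m) Num.min 1 `|val x - val (P j)|.
have dist_cont j : continuous (fun x : D => `|val x - val (P j)| : R).
  move=> x; apply: (@continuous_comp D 'rV[R]_d R val
    (fun y => `|y - val (P j)|)); first exact: initial_continuous.
  apply: (@cvg_norm _ _ _ _ (nbhs_filter (val x))).
  exact: (cvgB cvg_id (cvg_cst _)).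
have h_bcont : h \in bcont.
  apply/bcontP; split.
    rewrite /h; apply: continuous_big => [|j _].
      exact: mul_continuous.
    move=> x; apply: (@continuous_min _ _ (cst 1)
      (fun x : D => `|val x - val (P j)| : R)); first exact: cst_continuous.
    exact: dist_cont.
  exists 1 => x; rewrite normr_prod prodr_ile1// => j _.
  by rewrite normr_ge0/= ger0_norm ?ge_min ?lexx// le_min ler01 normr_ge0.
exists (BCFun h_bcont).
  apply/null_spaceP => j; rewrite /= /h (bigD1 j)//= subrr normr0.
  by rewrite min_r ?mul0r.
apply/eqP => /(congr1 (fun f : bcfun R D => f (SigSub (mem_set (UD _ Uq))))).
move=> /eqP /= /prodf_eq0[j _].
by rewrite gt_eqF// lt_min ltr01 normr_gt0 subr_eq0 qP.
Qed.

End sampling_theory.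

(** * Comparison of the two suprema *)

Theorem lemma7p3 (R : realType) (d : nat) (d_gt0 : (0 < d)%N)
    (D : set 'rV[R]_d) (D_domain : is_domain D)
    (V : set (bcfun R D)) (V_fin_dim : finite_dim_subspace V)
    (V_neq0 : V != [set 0])
    (m : nat) (P : 'I_m -> D) (P_inj : injective P)
    (NV0 : null_space P `&` V = [set 0]) :
  ((2^-1)%:E * sampling_sup P V <= mu (null_space P) V /\
   mu (null_space P) V <= 2%:E * sampling_sup P V)%E.
Proof.
have V0 : V 0 by have [] : (null_space P `&` V) 0 by rewrite NV0.
have [w Vw w0] : exists2 w, V w & w != 0.
  apply: contrapT => none; move/eqP: V_neq0; apply.
  apply/seteqP; split=> [v Vv|_ ->//].
  by apply: contrapT => /eqP v0; apply: none; exists v.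
have posM v := @sample_max_gt0 _ _ _ _ P V v NV0.
rewrite (sampling_supE NV0); split.
  have mu_ge1 : (1 <= mu (null_space P) V)%E.
    have [z Nz z0] := null_space_neq0 P d_gt0 D_domain.
    have nz0 : 0 < `|z| by rewrite normr_gt0.
    have := @mu_ge _ _ (null_space P) V z 0 `|z| Nz V0 nz0.
    by rewrite subr0 lexx divff ?gt_eqF//; exact.
  rewrite lee_pdivrMl//; apply/ereal_supP => _ [v [Vv /eqP v0] <-].
  have M0 := posM v Vv v0; set M := sample_max P v in M0 *.
  rewrite -lee_pdivrMl// -EFinM.
  (* Truncation only gives [|v| / M - 1 <= mu], which is at least
     [|v| / (2 * M)] exactly when [2 * M <= |v|]. *)
  have [vM|vM] := leP `|v| (2 * M).
    apply: le_trans mu_ge1; rewrite lee_fin ler_pdivrMl// mulr1.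
    by rewrite ler_pdivrMr.
  pose u := clamp M v; have uM : `|u| <= M by apply: norm_clamp; exact: ltW.
  have vu : `|v| - M <= `|v - u|.
    by apply: le_trans (lerB_dist _ _); rewrite lerD2l lerN2.
  apply: (@le_trans _ _ (`|v - u| / M)%:E).
    by rewrite lee_fin mulrA ler_pM2r ?invr_gt0//; lra.
  apply: (@mu_ge _ _ _ _ (v - u) v M) => //.
  - apply/null_spaceP => j; apply/eqP; rewrite subr_eq0; apply/eqP.
    by rewrite -[LHS](@clamp_id _ _ M)// sample_le_max.
  - by rewrite addrAC subrr add0r normrN.
  - by rewrite -normr_gt0; lra.
set L := ereal_sup _.
have leL v : V v -> v != 0 -> ((`|v| / sample_max P v)%:E <= L)%E.
  by move=> Vv v0; apply: ereal_sup_ubound; exists v => //; split=> //; apply/eqP.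
have L1 : (1 <= L)%E.
  apply: le_trans (leL w Vw w0).
  by rewrite lee_fin ler_pdivlMr ?posM// mul1r sample_max_le_norm.
case: L L1 leL => [l||] //; last by rewrite gt0_muley ?leey// lte_fin.
rewrite lee_fin => l1 leL; rewrite -EFinM; apply: mu_le => [|x y Nx Vy].
  by rewrite mulr_gt0// (lt_le_trans _ l1).
have yM : `|y| <= l * sample_max P y.
  have [->|y0] := eqVneq y 0.
    by rewrite normr0 mulr_ge0 ?sample_max_ge0// (le_trans _ l1).
  by have := leL y Vy y0; rewrite lee_fin ler_pdivrMr// posM.
(* [x] vanishes at the sample points, so [y] has there the values of [y - x]. *)
have Mxy : sample_max P y <= `|x - y|.
  apply: sample_max_le => // j.
  have /null_spaceP/(_ j) xj := Nx.
  have := sup_norm_ge (x - y) (P j).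
  by rewrite (_ : (x - y) (P j) = x (P j) - y (P j))// xj sub0r normrN.
have xy : `|x| <= `|x - y| + `|y| by rewrite -{1}(subrK y x) ler_normD.
have := normr_ge0 (x - y); have := sample_max_ge0 P y; nra.
Qed.
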